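(* Let $n\ge1$ be an integer, let $\Phi$ and $\Psi$ be Orlicz functions and let $0\le\lambda,\mu<1$. Then $M^{\Psi,\mu}(0)\hookrightarrow M^{\Phi,\lambda}(0)$ (as spaces of functions on $\mathbb{R}^n$) if and only if there are constants $A_1,A_2>0$ such that (i) $\Phi\big(\frac{u}{A_1}\big)\le\Psi(u)^{\frac{\lambda-1}{\mu-1}}$ for all $u>0$, and (ii) $\Phi\big(\frac{u}{A_2}\big)\le\Psi(u)\,r^{\lambda-\mu}$ for all $u,r>0$ satisfying $\Psi^{-1}(r^{\mu-1})<u$.
   Context: An Orlicz function is a strictly increasing, continuous, convex function $\Phi\colon[0,\infty)\to[0,\infty)$ with $\Phi(0)=0$; $\Phi^{-1}$ denotes its inverse. For $r>0$ let $B_r=\{x\in\mathbb{R}^n:|x|<r\}$, and let $|E|$ denote the Lebesgue measure of $E$. For $\lambda\in\mathbb{R}$, the central Morrey--Orlicz space $M^{\Phi,\lambda}(0)$ consists of all $f\in L^1_{loc}(\mathbb{R}^n)$ with $$\|f\|_{M^{\Phi,\lambda}(0)}=\sup_{r>0}\|f\|_{\Phi,\lambda,B_r}<\infty,\qquad \|f\|_{\Phi,\lambda,B_r}=\inf\Big\{\varepsilon>0:\frac{1}{|B_r|^{\lambda}}\int_{B_r}\Phi\Big(\frac{|f(x)|}{\varepsilon}\Big)dx\le1\Big\}.$$ The notation $M^{\Psi,\mu}(0)\hookrightarrow M^{\Phi,\lambda}(0)$ means continuous inclusion: $M^{\Psi,\mu}(0)\subset M^{\Phi,\lambda}(0)$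 and there is a constant $C>0$ such that $\|f\|_{M^{\Phi,\lambda}(0)}\le C\|f\|_{M^{\Psi,\mu}(0)}$ for all $f\in M^{\Psi,\mu}(0)$. *)

(* Defs.v *)
From HB Require Import structures.
From mathcomp Require Import all_boot all_order all_algebra.
From mathcomp Require Import all_classical all_reals all_analysis.

Set Implicit Arguments.
Unset Strict Implicit.
Unset Printing Implicit Defensive.
Import Order.TTheory GRing.Theory Num.Theory.
Import numFieldNormedType.Exports.
Local Open Scope classical_set_scope.
Local Open Scope ring_scope.

Notation Rtuple R n := (n.-tuple (measurableTypeR R)).

Section borel_lebesgue.
Context {R : realType}.

Definition tuple_cons (n : nat) (p : measurableTypeR R * Rtuple R n) :
  Rtuple R n.+1 := [tuple of p.1 :: p.2].

Lemma measurable_tuple_cons (n : nat) : measurable_fun setT (@tuple_cons n).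
Proof. exact: measurable_cons. Qed.

Definition tuple_uncons (n : nat) (t : Rtuple R n.+1) :
  measurableTypeR R * Rtuple R n := (thead t, [tuple of behead t]).

Lemma measurable_tuple_uncons (n : nat) :
  measurable_fun setT (@tuple_uncons n).
Proof.
apply: measurable_fun_pair; first exact: measurable_tnth.
exact: measurable_behead.
Qed.

Lemma tuple_consK (n : nat) : cancel (@tuple_cons n) (@tuple_uncons n).
Proof.
by move=> [x t]; congr pair; exact/val_inj.
Qed.

Section borel_lebesgue_step.
Variables (n : nat) (m : {sigma_finite_measure set (Rtuple R n) -> \bar R}).

Definition tuple_product_measure : set (Rtuple R n.+1) -> \bar R :=
  pushforward (lebesgue_measure \x m)%E (@tuple_cons n).

Let tpm0 : tuple_product_measure set0 = 0%E.
Proof. by rewrite /tuple_product_measure /pushforward preimage_set0 measure0. Qed.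

Let tpm_ge0 A : (0 <= tuple_product_measure A)%E.
Proof. by rewrite /tuple_product_measure /pushforward measure_ge0. Qed.

Let tpm_sigma_additive : semi_sigma_additive tuple_product_measure.
Proof.
exact: (@measure_semi_sigma_additive _ _ _
  (measure_function_pushforward__canonical__measure_function_Measure
    (lebesgue_measure \x m)%E (@measurable_tuple_cons n))).
Qed.

HB.instance Definition _ := isMeasure.Build _ _ _ tuple_product_measure
  tpm0 tpm_ge0 tpm_sigma_additive.

Let tpm_sigma_finite : sigma_finite setT tuple_product_measure.
Proof.
have /sigma_finiteP[F [FT ndF Foo]] := sigma_finiteT (@lebesgue_measure R).
have /sigma_finiteP[G [GT ndG Goo]] := sigma_finiteT m.
exists (fun k => @tuple_uncons n @^-1` (F k `*` G k)).
  rewrite -preimage_bigcup (_ : \bigcup_k _ = setT) ?preimage_setT//.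
  apply/seteqP; split=> // -[x y] _.
  have [i _ Fix] : (\bigcup_i F i) x by rewrite -FT.
  have [j _ Gjy] : (\bigcup_i G i) y by rewrite -GT.
  exists (maxn i j) => //; split => /=.
  - by move: x Fix; exact/subsetPset/ndF/leq_maxl.
  - by move: y Gjy; exact/subsetPset/ndG/leq_maxr.
move=> k; have [mF Fk] := Foo k; have [mG Gk] := Goo k; split.
  rewrite -[X in measurable X]setTI.
  by apply: measurable_tuple_uncons => //; exact: measurableX.
rewrite /tuple_product_measure /pushforward -comp_preimage.
rewrite (_ : _ \o _ = id); last by apply/funext => p /=; rewrite tuple_consK.
by rewrite preimage_id product_measure1E// lte_mul_pinfty// ge0_fin_numE.
Qed.

HB.instance Definition _ := Measure_isSigmaFinite.Build _ _ _
  tuple_product_measure tpm_sigma_finite.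

End borel_lebesgue_step.

(* Iterated product of one-dimensional Lebesgue measures, on Borel sets. *)
Fixpoint borel_lebesgue (n : nat) :
    {sigma_finite_measure set (Rtuple R n) -> \bar R} :=
  if n is n'.+1 then tuple_product_measure (borel_lebesgue n')
  else \d_([tuple] : Rtuple R 0).

End borel_lebesgue.

(* Points of R^n, with the sigma-algebra of Lebesgue measurable sets: the
   Caratheodory measurable sets of the outer measure induced by the Borel
   measure borel_lebesgue. *)
Definition Rn (R : realType) (n : nat) : measurableType _ :=
  caratheodory_type ((@borel_lebesgue R n)^*)%mu.

Definition lebesgue {R : realType} (n : nat) : set (Rn R n) -> \bar R :=
  @completed_measure_extension _ _ _ (@borel_lebesgue R n).

HB.instance Definition _ (R : realType) (n : nat) :=
  Measure.on (@lebesgue R n).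

HB.instance Definition _ (R : realType) (n : nat) :=
  Measure_isSigmaFinite.Build _ _ _ (@lebesgue R n)
    (completed_measure_extension_sigma_finite (sigma_finiteT (borel_lebesgue n))).

Lemma measurable_box (R : realType) (n : nat) (a b : 'I_n -> R) :
  measurable [set x : Rtuple R n | forall i, a i <= tnth x i <= b i].
Proof.
rewrite (_ : mkset _ = \bigcap_(i in [set: 'I_n])
    ((fun x : Rtuple R n => tnth x i) @^-1` `[a i, b i])); last first.
  by apply/seteqP; split=> x /= h i; have := h i; rewrite /= in_itv/=; auto.
apply: fin_bigcap_measurable => // i _.
by rewrite -[X in measurable X]setTI; exact: measurable_tnth.
Qed.

Lemma borel_lebesgue_box (R : realType) (n : nat) (a b : 'I_n -> R) :
  (forall i, a i <= b i) ->
  borel_lebesgue n [set x : Rtuple R n | forall i, a i <= tnth x i <= b i] =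
  (\prod_(i < n) (b i - a i))%:E.
Proof.
elim: n a b => [|n IHn] a b ab.
  by rewrite big_ord0 /= diracE mem_set//= => -[].
rewrite big_ord_recl /= /tuple_product_measure /pushforward.
rewrite (_ : _ @^-1` _ = `[a ord0, b ord0] `*` [set x : Rtuple R n |
    forall i, a (lift ord0 i) <= tnth x i <= b (lift ord0 i)]); last first.
  apply/seteqP; split=> -[x t] /=.
    move=> h; split; first by have := h ord0; rewrite /= in_itv.
    by move=> i; have := h (lift ord0 i); rewrite tnthS.
  rewrite in_itv/= => -[h0 h] i.
  by have [j ->|->//] := unliftP ord0 i; rewrite tnthS; exact: h.
rewrite product_measure1E//; last exact: measurable_box.
rewrite IHn// EFinM; congr (_ * _)%E.
apply: etrans (lebesgue_measure_itv `[a ord0, b ord0]) _; rewrite /= lte_fin.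
by case: ltgtP (ab ord0) => // -> _; rewrite subrr.
Qed.

Lemma lebesgue_box (R : realType) (n : nat) (a b : 'I_n -> R) :
  (forall i, a i <= b i) ->
  lebesgue [set x : Rn R n | forall i, a i <= tnth x i <= b i] =
  (\prod_(i < n) (b i - a i))%:E.
Proof.
move=> ab; rewrite -borel_lebesgue_box//.
by rewrite /lebesgue /completed_measure_extension /= measurable_mu_extE//;
  exact: measurable_box.
Qed.

Section morrey_orlicz.
Context {R : realType}.

(* An Orlicz function is represented by a function on R of which only the
   restriction to [0, +oo[ matters. *)
Definition orlicz (Phi : R -> R) : Prop :=
  [/\ {homo Phi : u / 0 <= u}, Phi 0 = 0,
      {in `[0, +oo[ &, {homo Phi : u v / u < v}},
      {within `[0, +oo[, continuous Phi} &
      convex_function (`[0, +oo[%classic : set R) Phi].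

Definition orlicz_inv (Phi : R -> R) : R -> R :=
  pinv (`[0, +oo[%classic : set R) Phi.

Variable n : nat.
Implicit Types (f : Rn R n -> R) (Phi : R -> R).

Definition enorm (x : Rn R n) : R := Num.sqrt (\sum_(i < n) tnth x i ^+ 2).

Definition origin_ball (r : R) : set (Rn R n) := [set x | enorm x < r].

(* Tuples carry no topology in the library; compactness of a set of points is
   that of the corresponding set of row vectors. Functions are honest
   functions rather than classes modulo a.e. equality. *)
Definition loc_integrable f : Prop :=
  measurable_fun setT f /\
  forall K : set 'rV[R]_n, compact K ->
    (\int[@lebesgue R n]_(x in [set x : Rn R n | K (\row_i tnth x i)])
       `|f x|%:E < +oo)%E.

(* The infimum is taken in the extended reals, so that it is +oo when no e is
   admissible. *)
Definition ball_luxemburg Phi (lambda : R) (r : R) f : \bar R :=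
  ereal_inf [set e%:E | e in [set e : R | 0 < e /\
    (((fine (lebesgue (origin_ball r)) `^ lambda)^-1)%:E *
     \int[@lebesgue R n]_(x in origin_ball r) (Phi (`|f x| / e))%:E <= 1)%E]].

Definition morrey_orlicz_norm Phi (lambda : R) f : \bar R :=
  ereal_sup [set ball_luxemburg Phi lambda r f | r in [set r : R | 0 < r]].

Definition morrey_orlicz Phi (lambda : R) : set (Rn R n -> R) :=
  [set f | loc_integrable f /\ (morrey_orlicz_norm Phi lambda f < +oo)%E].

Definition morrey_orlicz_embedding (Psi : R -> R) (mu : R) (Phi : R -> R)
    (lambda : R) : Prop :=
  morrey_orlicz Psi mu `<=` morrey_orlicz Phi lambda /\
  exists2 C : R, 0 < C & forall f, morrey_orlicz Psi mu f ->
    (morrey_orlicz_norm Phi lambda f <= C%:E * morrey_orlicz_norm Psi mu f)%E.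

End morrey_orlicz.

(* Main.v *)
(* Only the volume t = |B_r| matters, and by scaling it takes every value in
   [0, +oo[.

   Sufficiency: if the modular of g := |f| / e over B_r is at most t ^ mu, then
   (ii) where Psi g > t ^ (mu - 1), and (i) elsewhere, give the pointwise bound
   Phi (g / max A1 A2) <= t ^ (lambda - mu) Psi g + t ^ (lambda - 1), whose
   integral over B_r is at most 2 t ^ lambda; convexity absorbs the factor 2.

   Necessity: f = u 1_E, with E the difference of two centred balls of volumes
   t > s', has M^{Psi, mu}-norm at most 1 as soon as
   Psi u * (t - s') <= t ^ mu, and then the embedding yields
   Phi (u / (2 C)) * (t - s') <= t ^ lambda. Condition (i) is the case s' = 0,
   Psi u = t ^ (mu - 1), and (ii) the case t - s' = t ^ mu / Psi u. *)
Require Import Defs.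
From mathcomp Require Import all_boot all_order all_algebra.
From mathcomp Require Import all_classical all_reals all_analysis.
From mathcomp Require Import measurable_realfun ring lra.
Import Order.TTheory GRing.Theory Num.Theory.
Import numFieldNormedType.Exports.
Local Open Scope classical_set_scope.
Local Open Scope ring_scope.

(** * Volumes of centred balls: scaling, positivity, finiteness, attained values *)

Section ball_volume.
Context {R : realType}.

(** By uniqueness of Lebesgue measure: [c] times its pushforward under multiplication by [c] agrees
    with it on half-open intervals. *)
Lemma lebesgue_measure_dilation (c : R) (A : set (measurableTypeR R)) :
  0 < c -> measurable A ->
  (c%:E * lebesgue_measure ((fun x => c * x)%R @^-1` A) = lebesgue_measure A)%E.
Proof.
move=> c0 mA.
have mdil : measurable_fun setT
    ((fun x => c * x) : measurableTypeR R -> measurableTypeR R).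
  exact: mulrl_measurable.
apply/esym/(@lebesgue_measure_unique R
  (mscale (NngNum (ltW c0))
    (measure_function_pushforward__canonical__measure_function_Measure
      (@lebesgue_measure R) mdil))) => // _ [[a b]] _ <-.
transitivity (c%:E * lebesgue_measure
    ((fun x => c * x)%R @^-1` `]a, b]%classic))%E;
  last by [].
rewrite (_ : _ @^-1` _ = `]a / c, b / c]%classic); last first.
  apply/seteqP; split=> x /=; rewrite !in_itv/= ltr_pdivrMr// ler_pdivlMr//;
    by rewrite mulrC.
rewrite [LHS]lebesgue_measure_itv/= [X in (_ * X)%E]lebesgue_measure_itv/=.
rewrite !lte_fin ltr_pM2r ?invr_gt0//; case: ifPn => _; last by rewrite mule0.
by rewrite -!EFinD -EFinM -mulrBl mulrCA divff ?mulr1// gt_eqF.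
Qed.

Definition dilation (n : nat) (c : R) (x : Rtuple R n) : Rtuple R n :=
  [tuple c * tnth x i | i < n].

Lemma measurable_dilation (n : nat) (c : R) :
  measurable_fun setT (dilation n c).
Proof.
apply/measurable_fun_tnthP => i.
rewrite (_ : _ \o _ = (fun x : Rtuple R n => c * tnth x i)); last first.
  by apply/funext => x /=; rewrite tnth_mktuple.
by apply: measurable_funM => //; exact: measurable_tnth.
Qed.

Lemma dilation_cons (n : nat) (c : R) (p : R * Rtuple R n) :
  dilation n.+1 c (tuple_cons p) = tuple_cons (c * p.1, dilation n c p.2).
Proof.
apply/eq_from_tnth => i; rewrite tnth_mktuple.
by have [j ->|->] := unliftP ord0 i; rewrite ?tnthS ?tnth0 ?tnth_mktuple.
Qed.

(** Induction on [n]: the pushforward of the product measure under [phi], scaled by [c ^+ n.+1], has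
    the right value on rectangles, and these determine the product measure. *)
Lemma borel_lebesgue_dilation (n : nat) (c : R) (A : set (Rtuple R n)) :
  0 < c -> measurable A ->
  ((c ^+ n)%:E%E * borel_lebesgue n (dilation n c @^-1` A) =
    borel_lebesgue n A)%E.
Proof.
move=> c0; elim: n A => [|n IHn] A mA.
  (* In dimension 0 the measure is the Dirac mass at the empty tuple, which every dilation fixes. *)
  rewrite mul1e /= !diracE; congr ((_ : bool)%:R%:E).
  by apply/idP/idP; rewrite !inE/= (_ : dilation _ _ _ = [tuple])//;
    exact: tuple0.
have cn0 : 0 <= c ^+ n.+1 by rewrite exprn_ge0// ltW.
pose phi (p : measurableTypeR R * Rtuple R n) : measurableTypeR R * Rtuple R n :=
  (c * p.1, dilation n c p.2).
have mphi : measurable_fun setT phi.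
  apply: measurable_fun_pair.
    by apply: measurable_funM => //; exact: measurable_fst.
  by apply: measurableT_comp; [exact: measurable_dilation|exact: measurable_snd].
have mA' : measurable (@tuple_cons R n @^-1` A).
  by rewrite -[X in measurable X]setTI; exact: measurable_tuple_cons.
rewrite /= /tuple_product_measure /pushforward.
rewrite [RHS](@product_measure_unique _ _ _ _ R lebesgue_measure
  (borel_lebesgue n) (mscale (NngNum cn0)
    (measure_function_pushforward__canonical__measure_function_Measure
      (lebesgue_measure \x borel_lebesgue n)%E mphi)))//.
  congr (_ * (_ \x _)%E _)%E.
  by apply/funext => p; rewrite /preimage/= dilation_cons.
move=> B C mB mC.
transitivity ((c ^+ n.+1)%:E * (lebesgue_measure \x borel_lebesgue n)
    (((fun x => c * x)%R @^-1` B) `*` (dilation n c @^-1` C)))%E; first by [].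
rewrite product_measure1E//; last 2 first.
- by rewrite -[X in measurable X]setTI; exact: mulrl_measurable.
- by rewrite -[X in measurable X]setTI; exact: measurable_dilation.
rewrite exprS EFinM muleACA IHn//; congr (_ * _)%E.
exact: lebesgue_measure_dilation.
Qed.

Lemma measurable_enorm (n : nat) :
  measurable_fun setT (@enorm R n : Rtuple R n -> R).
Proof.
apply: measurableT_comp.
  apply: continuous_measurable_fun; exact: sqrt_continuous.
apply: measurable_sum => i; apply: measurable_funX.
exact: measurable_tnth.
Qed.

Lemma borel_origin_ball (n : nat) (r : R) :
  measurable (@origin_ball R n r : set (Rtuple R n)).
Proof.
rewrite (_ : @origin_ball R n r = (@enorm R n : Rtuple R n -> R) @^-1` `]-oo, r[).
  by rewrite -[X in measurable X]setTI; exact: measurable_enorm.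
by apply/seteqP; split=> x /=; rewrite in_itv.
Qed.

Lemma lebesgueE (n : nat) (A : set (Rtuple R n)) :
  measurable A -> lebesgue (A : set (Rn R n)) = borel_lebesgue n A.
Proof. exact: measurable_mu_extE. Qed.

Lemma measurable_Rn (n : nat) (A : set (Rtuple R n)) :
  measurable A -> measurable (A : set (Rn R n)).
Proof. by move=> mA; apply: sub_caratheodory; exact: sub_sigma_algebra. Qed.

Lemma measurable_origin_ball (n : nat) (r : R) : measurable (@origin_ball R n r).
Proof. by apply: measurable_Rn; exact: borel_origin_ball. Qed.

Lemma enorm_dilation (n : nat) (c : R) (x : Rtuple R n) :
  0 <= c -> enorm (dilation n c x : Rn R n) = c * enorm (x : Rn R n).
Proof.
move=> c0; rewrite /enorm -[c in RHS]ger0_norm// -sqrtr_sqr -sqrtrM ?sqr_ge0//.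
congr Num.sqrt; rewrite mulr_sumr; apply: eq_bigr => i _.
by rewrite tnth_mktuple exprMn.
Qed.

Lemma lebesgue_origin_ballE (n : nat) (r : R) : 0 < r ->
  lebesgue (@origin_ball R n r) = ((r ^+ n)%:E * lebesgue (@origin_ball R n 1))%E.
Proof.
move=> r0; rewrite !lebesgueE; [|exact: borel_origin_ball..].
rewrite -(borel_lebesgue_dilation _ r)//; last exact: borel_origin_ball.
congr (_ * borel_lebesgue n _)%E; apply/seteqP; split=> x /=;
  by rewrite /origin_ball /= enorm_dilation ?ltW// -ltr_pdivlMl// mulVf// gt_eqF.
Qed.

(** The unit ball lies between two cubes centred at the origin, whose volumes are given by
    [lebesgue_box]. *)
Lemma lebesgue_origin_ball1 (n : nat) :
  exists2 v : R, 0 < v & lebesgue (@origin_ball R n 1) = v%:E.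
Proof.
(* Points of the cube of half-side [a] have squared norm at most [n / (n + 1) ^ 2], which is below
   1, also for [n = 0]. *)
pose a : R := n.+1%:R^-1.
have a0 : 0 < a by rewrite invr_gt0.
have lo : ((\prod_(i < n) (a - (- a)))%:E <= lebesgue (@origin_ball R n 1))%E.
  rewrite -(@lebesgue_box R n (fun=> - a) (fun=> a)); last first.
    by move=> _; rewrite ge0_cp// ltW.
  apply: le_measure; rewrite ?inE.
  - by apply: measurable_Rn; exact: measurable_box.
  - exact: measurable_origin_ball.
  - move=> x /= xa; rewrite /origin_ball /= /enorm -sqrtr1 ltr_sqrt//.
    apply: (@le_lt_trans _ _ (\sum_(i < n) a ^+ 2)).
      apply: ler_sum => i _; rewrite -real_normK ?num_real//.
      by apply: lerXn2r; rewrite ?nnegrE ?(ltW a0)// ler_norml.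
    rewrite sumr_const card_ord -mulr_natl /a.
    rewrite exprVn ltr_pdivrMr ?exprn_gt0// mul1r -natrX ltr_nat.
    by rewrite -mulnn leq_pmulr.
have hi : (lebesgue (@origin_ball R n 1) <= (\prod_(i < n) (1 - (- 1)))%:E)%E.
  rewrite -(@lebesgue_box R n (fun=> - 1) (fun=> 1)); last by move=> _; lra.
  apply: le_measure; rewrite ?inE.
  - exact: measurable_origin_ball.
  - by apply: measurable_Rn; exact: measurable_box.
  - move=> x /= x1 i; rewrite -ler_norml -(@ler_pXn2r _ 2) ?nnegrE// expr1n.
    rewrite real_normK ?num_real//.
    move: x1; rewrite /origin_ball /= /enorm -[X in _ < X]sqrtr1 ltr_sqrt// => /ltW.
    apply: le_trans; rewrite (bigD1 i)//= lerDl.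
    by apply: sumr_ge0 => j _; exact: sqr_ge0.
exists (fine (lebesgue (@origin_ball R n 1))).
  apply: fine_gt0; rewrite (lt_le_trans _ lo) ?(le_lt_trans hi) ?ltry//.
  by rewrite lte_fin prodr_gt0// => i _; rewrite opprK addr_gt0.
by rewrite fineK// ge0_fin_numE// (le_lt_trans hi) ?ltry.
Qed.

Lemma lebesgue_origin_ball (n : nat) (r : R) : 0 < r ->
  exists2 v : R, 0 < v & lebesgue (@origin_ball R n r) = v%:E.
Proof.
move=> r0; rewrite lebesgue_origin_ballE//.
have [v v0 ->] := lebesgue_origin_ball1 n.
by exists (r ^+ n * v); [rewrite mulr_gt0// exprn_gt0|rewrite EFinM].
Qed.

Lemma origin_ball0 (n : nat) : @origin_ball R n (0 : R) = set0.
Proof.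
by apply/seteqP; split=> x //=; rewrite /origin_ball /= /enorm ltNge sqrtr_ge0.
Qed.

(** Volume grows like the [n]-th power of the radius, so an [n]-th root, available since [n] is
    positive, gives the radius; volume 0 is that of the empty ball of radius 0. *)
Lemma exists_origin_ball_volume (n : nat) (t : R) : (1 <= n)%N -> 0 <= t ->
  exists2 r : R, 0 <= r & lebesgue (@origin_ball R n r) = t%:E.
Proof.
move=> n1; rewrite le_eqVlt => /predU1P[<-|t0].
  by exists 0 => //; rewrite origin_ball0 measure0.
have [v v0 vE] := lebesgue_origin_ball1 n.
exists ((t / v) `^ n%:R^-1); first exact: powR_ge0.
rewrite lebesgue_origin_ballE ?powR_gt0 ?divr_gt0// vE.
rewrite -powR_mulrn ?powR_ge0// -powRrM mulVf ?pnatr_eq0 -?lt0n//.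
by rewrite powRr1 ?ltW ?divr_gt0// -EFinM divfK// gt_eqF.
Qed.

End ball_volume.

(** * Growth, inversion and measurability of Orlicz functions *)

Section orlicz_functions.
Context {R : realType} (Phi : R -> R).
Hypothesis oPhi : orlicz Phi.

Lemma orlicz_ge0 (u : R) : 0 <= u -> 0 <= Phi u.
Proof. by case: oPhi => + _ _ _ _; exact. Qed.

Lemma orlicz_lt (u v : R) : 0 <= u -> u < v -> Phi u < Phi v.
Proof.
case: oPhi => _ _ + _ _ u0 uv; apply => //; rewrite in_itv/= ?u0// andbT.
by rewrite (le_trans u0)// ltW.
Qed.

Lemma orlicz_le (u v : R) : 0 <= u -> u <= v -> Phi u <= Phi v.
Proof.
move=> u0; rewrite le_eqVlt => /predU1P[->//|uv].
exact/ltW/orlicz_lt.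
Qed.

Lemma orlicz_gt0 (u : R) : 0 < u -> 0 < Phi u.
Proof.
move=> u0; case: oPhi => _ Phi0 _ _ _.
by rewrite -[ltLHS]Phi0; exact: orlicz_lt.
Qed.

(** Convexity between [0] and [u], together with [Phi 0 = 0]. It lets a constant factor be absorbed
    into the argument of [Phi]. *)
Lemma orlicz_contract (t u : R) :
  0 <= t <= 1 -> 0 <= u -> Phi (t * u) <= t * Phi u.
Proof.
move=> /andP[t0 t1] u0; case: oPhi => _ Phi0 _ _ cvx.
have cvx0 : Phi (t * u + (1 - t) * 0) <= t * Phi u + (1 - t) * Phi 0.
  by apply: (cvx (Itv01 t0 t1)); rewrite inE/= in_itv/= ?u0 ?lexx.
by move: cvx0; rewrite Phi0 !mulr0 !addr0.
Qed.

Lemma orlicz_surj (s : R) : 0 <= s -> exists2 u : R, 0 <= u & Phi u = s.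
Proof.
move=> s0; have P1 : 0 < Phi 1 by exact: orlicz_gt0.
(* Since [M] is at least 1, convexity gives [M * Phi 1 <= Phi M]; since [M] is at least [s / Phi 1],
   the value [s] is reached on [[0, M]]. *)
pose M := Num.max 1 (s / Phi 1).
have M1 : 1 <= M by rewrite le_max lexx.
have M0 : 0 < M by exact: lt_le_trans M1.
have sM : s <= Phi M.
  have := @orlicz_contract M^-1 M _ (ltW M0).
  rewrite mulVf ?gt_eqF// invr_ge0 ltW//= invf_le1// => /(_ M1).
  rewrite ler_pdivlMl//; apply: le_trans.
  by rewrite -ler_pdivrMr// le_max lexx orbT.
case: oPhi => _ Phi0 _ cPhi _.
have [||c] := @IVT R Phi 0 M s (ltW M0).
- apply: continuous_subspaceW cPhi => x /=.
  by rewrite !in_itv/= andbT => /andP[].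
- by rewrite Phi0 min_l ?orlicz_ge0// ?max_r ?orlicz_ge0 ?(ltW M0)// s0.
- by rewrite in_itv/= => /andP[c0 _] <-; exists c.
Qed.

(** Turns the side condition of (ii) into a comparison of [Psi u] with [r ^ (mu - 1)]. *)
Lemma orlicz_inv_lt (s u : R) :
  0 <= s -> 0 <= u -> (orlicz_inv Phi s < u) = (s < Phi u).
Proof.
move=> s0 u0; have [w w0 <-] := @orlicz_surj s s0.
have -> : orlicz_inv Phi (Phi w) = w.
  rewrite /orlicz_inv pinvKV ?inE/= ?in_itv/= ?w0// => x y.
  rewrite !inE/= !in_itv/= !andbT => x0 y0 xy.
  by case: (ltgtP x y) => // [/(@orlicz_lt _ _ x0)|/(@orlicz_lt _ _ y0)];
    rewrite xy ltxx.
apply/idP/idP; first exact: orlicz_lt.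
by rewrite !ltNge; apply: contraNN; exact: orlicz_le.
Qed.

Lemma measurable_orlicz_comp d (T : measurableType d) (D : set T) (f : T -> R)
    (e : R) : 0 < e -> measurable_fun setT f ->
  measurable_fun D (fun x => (Phi (`|f x| / e))%:E).
Proof.
move=> e0 mf; apply/measurable_funTS/measurable_EFinP.
(* [Phi] is only evaluated at nonnegative points; precomposed with the positive part it becomes
   monotone on the whole line, hence measurable. *)
rewrite (_ : (fun _ => _) =
    (fun y => Phi (Num.max 0 y)) \o (fun x => `|f x| / e)); last first.
  by apply/funext => x /=; rewrite max_r// divr_ge0// ltW.
apply: measurableT_comp.
  apply: nondecreasing_measurable => // x y xy.
  apply: orlicz_le; first by rewrite le_max lexx.
  by rewrite ge_max !le_max lexx xy orbT.
by apply: measurable_funM => //; exact: measurableT_comp.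
Qed.

End orlicz_functions.

(** * Integrals of nonnegative functions *)

Section ge0_integral.
Context d (T : measurableType d) (R : realType) (m : {measure set T -> \bar R}).
Local Open Scope ereal_scope.

(** The integral is a supremum over the simple functions lying below, and a larger function has more
    of them. *)
Lemma ge0_le_integral_nonmeasurable (D : set T) (f g : T -> \bar R) :
  (forall x, D x -> 0 <= f x) -> (forall x, D x -> f x <= g x) ->
  \int[m]_(x in D) f x <= \int[m]_(x in D) g x.
Proof.
move=> f0 fg.
have g0 x : D x -> 0 <= g x by move=> Dx; apply: le_trans (fg _ Dx); exact: f0.
rewrite !ge0_integralE//; apply: ereal_sup_le => _ [h hf <-].
exists h => // x; apply: le_trans (hf x) _; rewrite /patch.
by case: ifPn => //; rewrite inE; exact: fg.
Qed.

(** Serves to bound the integrals over compact sets in [loc_integrable] by one over the whole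
    space. *)
Lemma ge0_integral_le_setT (D : set T) (f : T -> \bar R) :
  (forall x, 0 <= f x) -> \int[m]_(x in D) f x <= \int[m]_x f x.
Proof.
move=> f0; rewrite integral_mkcond; apply: ge0_le_integral_nonmeasurable.
  by move=> x _; rewrite /patch; case: ifP.
by move=> x _; rewrite /patch; case: ifP.
Qed.

Lemma ge0_integral_affine (D : set T) (f : T -> \bar R) (a b : R) :
  measurable D -> (forall x, D x -> 0 <= f x) -> measurable_fun D f ->
  (0 <= a)%R -> (0 <= b)%R ->
  \int[m]_(x in D) (a%:E * f x + b%:E) =
  a%:E * \int[m]_(x in D) f x + b%:E * m D.
Proof.
move=> mD f0 mf a0 b0; rewrite ge0_integralD//; last 2 first.
- by move=> x Dx; rewrite mule_ge0//; exact: f0.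
- exact: measurable_funeM.
by rewrite ge0_integralZl// integral_cst.
Qed.

Lemma ge0_integral_comp_indic (D E : set T) (h : R -> R) (u : R) :
  measurable D -> measurable E -> h 0%R = 0%R -> (0 <= h u)%R ->
  \int[m]_(x in D) (h (u * \1_E x)%R)%:E = (h u)%:E * m (E `&` D).
Proof.
move=> mD mE h0 hu; rewrite -integral_indic// -ge0_integralZl//; last first.
  by apply/measurable_EFinP/measurable_funTS; exact/measurable_indicP.
apply: eq_integral => x _; rewrite -EFinM indicE; congr EFin.
by case: (x \in E); rewrite ?mulr1 ?mulr0.
Qed.

End ge0_integral.

(** * Passing between Luxemburg norms and modulars *)

Section morrey_orlicz_norm.
Context {R : realType} {n : nat} (Phi : R -> R) (lambda : R).
Hypothesis oPhi : orlicz Phi.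
Implicit Types f : Rn R n -> R.

Lemma orlicz_modular_anti (D : set (Rn R n)) f (a b : R) : 0 < a -> a <= b ->
  (\int[@lebesgue R n]_(x in D) (Phi (`|f x| / b))%:E <=
   \int[@lebesgue R n]_(x in D) (Phi (`|f x| / a))%:E)%E.
Proof.
move=> a0 ab; have b0 := lt_le_trans a0 ab.
apply: ge0_le_integral_nonmeasurable => x _; rewrite lee_fin.
  by apply: orlicz_ge0 => //; rewrite divr_ge0// ltW.
apply: orlicz_le => //; first by rewrite divr_ge0// ltW.
by rewrite ler_wpM2l// lef_pV2.
Qed.

Lemma ball_luxemburg_le f (r v e : R) : 0 < v -> 0 < e ->
  lebesgue (@origin_ball R n r) = v%:E ->
  (\int[@lebesgue R n]_(x in origin_ball r) (Phi (`|f x| / e))%:E <=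
    (v `^ lambda)%:E)%E ->
  (ball_luxemburg Phi lambda r f <= e%:E)%E.
Proof.
move=> v0 e0 vE le_v; apply: ereal_inf_lbound; exists e => //; split => //=.
by rewrite vE/= lee_pdivrMl ?powR_gt0// mule1.
Qed.

(** The strict inequality yields an admissible [e'] below [e], whether or not the infimum is
    attained, and the modular decreases as its divisor grows. *)
Lemma ball_luxemburg_lt f (r v e : R) : 0 < v ->
  lebesgue (@origin_ball R n r) = v%:E ->
  (ball_luxemburg Phi lambda r f < e%:E)%E ->
  (\int[@lebesgue R n]_(x in origin_ball r) (Phi (`|f x| / e))%:E <=
    (v `^ lambda)%:E)%E.
Proof.
move=> v0 vE /ereal_inf_lt[_ [e' [/= e'0 +] <-]]; rewrite lte_fin vE/=.
rewrite lee_pdivrMl ?powR_gt0// mule1 => le_v e'e.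
by apply: le_trans le_v; exact/orlicz_modular_anti/ltW.
Qed.

Lemma ball_luxemburg_le_norm f (r : R) : 0 < r ->
  (ball_luxemburg Phi lambda r f <= morrey_orlicz_norm Phi lambda f)%E.
Proof. by move=> r0; apply: ereal_sup_ubound; exists r. Qed.

Lemma morrey_orlicz_norm_ge0 f : (0 <= morrey_orlicz_norm Phi lambda f)%E.
Proof.
apply: le_trans (ball_luxemburg_le_norm f _ (@ltr01 R)).
by apply: le_ereal_inf_tmp => _ [e [/= e0 _] <-]; rewrite lee_fin ltW.
Qed.

End morrey_orlicz_norm.

(** * Conditions (i) and (ii) imply the norm inequality *)

Section sufficiency.
Context {R : realType}.

Lemma le_powR_add (Phi Psi : R -> R) (lambda mu A1 A2 v g : R) :
  orlicz Phi -> orlicz Psi -> lambda < 1 -> mu < 1 -> 0 < A1 -> 0 < A2 ->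
  (forall u : R, 0 < u ->
    Phi (u / A1) <= Psi u `^ ((lambda - 1) / (mu - 1))) ->
  (forall u r : R, 0 < u -> 0 < r -> orlicz_inv Psi (r `^ (mu - 1)) < u ->
    Phi (u / A2) <= Psi u * r `^ (lambda - mu)) ->
  0 < v -> 0 <= g ->
  Phi (g / Num.max A1 A2) <= v `^ (lambda - mu) * Psi g + v `^ (lambda - 1).
Proof.
move=> oPhi oPsi l1 m1 A10 A20 H1 H2 v0; rewrite le_eqVlt => /predU1P[<-|g0].
  rewrite mul0r; case: (oPhi) => _ -> _ _ _.
  by rewrite addr_ge0 ?mulr_ge0 ?powR_ge0// orlicz_ge0.
have le_max_div A : 0 < A -> A <= Num.max A1 A2 ->
    Phi (g / Num.max A1 A2) <= Phi (g / A).
  move=> A0 AA; have M0 := lt_le_trans A0 AA.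
  apply: orlicz_le => //; first by rewrite divr_ge0// ltW.
  by rewrite ler_wpM2l ?(ltW g0)// lef_pV2.
have [vg|gv] := ltP (v `^ (mu - 1)) (Psi g).
  apply: (@le_trans _ _ (Psi g * v `^ (lambda - mu))).
    apply: le_trans (le_max_div A2 A20 _) (H2 _ _ g0 v0 _).
      by rewrite le_max lexx orbT.
    by rewrite orlicz_inv_lt ?powR_ge0// ltW.
  by rewrite mulrC lerDl powR_ge0.
apply: (@le_trans _ _ (v `^ (lambda - 1))); last first.
  by rewrite lerDr mulr_ge0 ?powR_ge0// orlicz_ge0// ltW.
apply: le_trans (le_max_div A1 A10 _) _; first by rewrite le_max lexx.
apply: le_trans (H1 _ g0) _.
(* Both sides of [Psi g <= v ^ (mu - 1)] can now be raised to the exponent of (i), which is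
   nonnegative as a quotient of two negative numbers. *)
have -> : v `^ (lambda - 1) = (v `^ (mu - 1)) `^ ((lambda - 1) / (mu - 1)).
  by rewrite -powRrM mulrC divfK// subr_eq0 lt_eqF.
apply: ge0_ler_powR => //; last 2 first.
- by rewrite nnegrE orlicz_ge0// ltW.
- by rewrite nnegrE powR_ge0.
by rewrite -mulrNN -invrN !opprB divr_ge0// subr_ge0 ltW.
Qed.

Lemma morrey_orlicz_norm_le (n : nat) (Phi Psi : R -> R) (lambda mu A : R)
    (f : Rn R n -> R) :
  orlicz Phi -> orlicz Psi -> 0 < A ->
  (forall v g : R, 0 < v -> 0 <= g ->
    Phi (g / A) <= v `^ (lambda - mu) * Psi g + v `^ (lambda - 1)) ->
  morrey_orlicz Psi mu f ->
  (morrey_orlicz_norm Phi lambda f <=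
    (2 * A)%:E * morrey_orlicz_norm Psi mu f)%E.
Proof.
move=> oPhi oPsi A0 le_Phi [[mf _] ].
have := morrey_orlicz_norm_ge0 Psi mu f.
case NE : (morrey_orlicz_norm Psi mu f) => [N| |]// N0 _.
rewrite lee_fin in N0; rewrite -EFinM; apply/lee_addgt0Pr => d d0.
have A20 : 0 < 2 * A by rewrite mulr_gt0.
(* The slack makes [e] positive even if [N = 0], and strictly larger than the Luxemburg norm on each
   ball, as [ball_luxemburg_lt] requires. *)
pose e := N + d / (2 * A).
have e0 : 0 < e by rewrite ltr_wpDl// divr_gt0.
have -> : ((2 * A * N)%:E + d%:E)%E = (2 * A * e)%:E.
  by rewrite -EFinD /e mulrDr [_ * (d / _)]mulrC divfK// gt_eqF.
apply: ge_ereal_sup => _ [r r0 <-].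
have [v v0 vE] := lebesgue_origin_ball n r r0.
apply: (ball_luxemburg_le _ _ _ _ _ _ v0 _ vE); first by rewrite mulr_gt0.
have Psi_le : (\int[@lebesgue R n]_(x in origin_ball r) (Psi (`|f x| / e))%:E <=
    (v `^ mu)%:E)%E.
  apply: (ball_luxemburg_lt _ _ oPsi _ _ _ _ v0 vE).
  apply: (le_lt_trans (ball_luxemburg_le_norm _ _ _ _ r0)).
  by rewrite NE lte_fin ltrDl divr_gt0.
have mPsi : measurable_fun (origin_ball r) (fun x => (Psi (`|f x| / e))%:E).
  exact: measurable_orlicz_comp.
have Psi0 (x : Rn R n) : 0 <= Psi (`|f x| / e).
  by rewrite orlicz_ge0// divr_ge0// ltW.
apply: (@le_trans _ _ (\int[@lebesgue R n]_(x in origin_ball r)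
  ((2^-1 * v `^ (lambda - mu))%:E * (Psi (`|f x| / e))%:E +
   (2^-1 * v `^ (lambda - 1))%:E))%E).
  apply: ge0_le_integral_nonmeasurable => x _; rewrite -?EFinM -?EFinD lee_fin.
    by rewrite orlicz_ge0// divr_ge0// ltW// mulr_gt0.
  (* Isolates the factor 1/2, which [orlicz_contract] moves outside [Phi]. *)
  have -> : `|f x| / (2 * A * e) = 2^-1 * (`|f x| / e / A).
    by rewrite -mulrA !invfM; ring.
  apply: le_trans (orlicz_contract _ oPhi _ _ _ _) _.
  - by rewrite invr_ge0 ler0n invf_le1// ler1n.
  - by rewrite !divr_ge0// ltW.
  rewrite [leRHS](_ : _ = 2^-1 * (v `^ (lambda - mu) * Psi (`|f x| / e) +
    v `^ (lambda - 1))); last by ring.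
  by rewrite ler_wpM2l// le_Phi// divr_ge0// ltW.
have mball := @measurable_origin_ball R n r.
rewrite (ge0_integral_affine _ _ _ _ _ _ _ _ mball _ mPsi).
(* Splits the target into two halves that match the two terms of the integral: the modular of [Psi]
   is at most [v ^ mu], and the ball has volume [v]. *)
have -> : v `^ lambda = 2^-1 * v `^ (lambda - mu) * v `^ mu +
    2^-1 * v `^ (lambda - 1) * v.
  have vD a : v `^ (lambda - a) * v `^ a = v `^ lambda.
    by rewrite -powRD ?subrK// (gt_eqF v0) implybT.
  rewrite -!mulrA vD -[X in _ * (_ * X)]powRr1 ?ltW// vD -mulrDl.
  by rewrite [_ + _](_ : _ = 1) ?mul1r//; lra.
rewrite EFinD; apply: leeD; last by rewrite [in leRHS]EFinM -vE.
by rewrite [leRHS]EFinM; apply: lee_wpmul2l => //;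
  rewrite lee_fin mulr_ge0// powR_ge0.
all: by move=> *; rewrite ?lee_fin// mulr_ge0// powR_ge0.
Qed.

End sufficiency.

(** * Indicators of annuli as test functions for the embedding *)

Section necessity.
Context {R : realType} {n : nat}.

Lemma integral_orlicz_indic (Phi : R -> R) (D E : set (Rn R n)) (u e : R) :
  orlicz Phi -> measurable D -> measurable E -> 0 < u -> 0 < e ->
  (\int[@lebesgue R n]_(x in D) (Phi (`|u * \1_E x| / e))%:E =
    (Phi (u / e))%:E * lebesgue (E `&` D))%E.
Proof.
move=> oPhi mD mE u0 e0.
rewrite (ge0_integral_comp_indic _ _ _ _ _ _ (fun y => Phi (`|y| / e)))//.
- by rewrite ger0_norm ?ltW.
- by rewrite normr0 mul0r; case: oPhi.
- by rewrite orlicz_ge0// divr_ge0// ltW.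
Qed.

Lemma loc_integrable_indic (E : set (Rn R n)) (u : R) :
  measurable E -> (lebesgue E < +oo)%E ->
  loc_integrable (fun x => u * \1_E x).
Proof.
move=> mE Eoo; split.
  exact/(measurable_funM (measurable_cst u))/measurable_indicP.
move=> K _; apply: (le_lt_trans (ge0_integral_le_setT _ _ _ _ _ _ _)) => //.
rewrite (ge0_integral_comp_indic _ _ _ _ _ _ Num.norm)//; last exact: normr0.
by rewrite setIT lte_mul_pinfty.
Qed.

(** With [x = v / t] in []0, 1]] this is [x <= x ^ mu], multiplied by [t ^ mu]. *)
Lemma ler_powR_scale (mu v t : R) : 0 <= mu < 1 -> 0 < v <= t ->
  v / t * t `^ mu <= v `^ mu.
Proof.
move=> /andP[m0 m1] /andP[v0 vt]; have t0 := lt_le_trans v0 vt.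
have -> : v `^ mu = (v / t) `^ mu * t `^ mu.
  by rewrite -powRM ?divfK ?gt_eqF// ?divr_ge0// ltW.
rewrite ler_wpM2r ?powR_ge0// -[leLHS]powRr1 ?divr_ge0 ?(ltW v0) ?(ltW t0)//.
apply: ger_powR; last exact: ltW.
by rewrite divr_gt0//= ler_pdivrMr// mul1r.
Qed.

Lemma subset_origin_ball (s r : R) :
  s <= r -> @origin_ball R n s `<=` origin_ball r.
Proof. by move=> sr x; rewrite /origin_ball /= => /lt_le_trans; apply. Qed.

Lemma le_lebesgue_origin_ball (s r s' t : R) :
  lebesgue (@origin_ball R n s) = s'%:E ->
  lebesgue (@origin_ball R n r) = t%:E -> s <= r -> s' <= t.
Proof.
move=> sE rE sr; rewrite -lee_fin -sE -rE.
apply: le_measure; rewrite ?inE; [exact: measurable_origin_ball..|].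
exact: subset_origin_ball.
Qed.

Lemma lebesgue_annulus (s r s' t : R) :
  lebesgue (@origin_ball R n s) = s'%:E ->
  lebesgue (@origin_ball R n r) = t%:E -> s <= r ->
  lebesgue (@origin_ball R n r `\` origin_ball s) = (t - s')%:E.
Proof.
move=> sE rE sr; transitivity (lebesgue (@origin_ball R n r) -
    lebesgue (@origin_ball R n r `&` origin_ball s))%E.
  apply: measureD; [exact: measurable_origin_ball..|].
  by rewrite [ltLHS]rE ltry.
by rewrite setIidr ?rE ?sE//; exact: subset_origin_ball.
Qed.

Lemma measurable_annulus (s r : R) :
  measurable (@origin_ball R n r `\` origin_ball s).
Proof. by apply: measurableD; exact: measurable_origin_ball. Qed.

(** A ball of radius [q] and volume [v] contains the annulus if [r <= q] and misses it if [q <= s].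
    In between it meets it in volume [v - s'], at most [v / t * (t - s')] because [v <= t], and
    [ler_powR_scale] concludes. *)
Lemma annulus_norm_le1 (Psi : R -> R) (mu u s r s' t : R) :
  orlicz Psi -> 0 <= mu < 1 -> 0 < u -> 0 <= s' < t ->
  lebesgue (@origin_ball R n s) = s'%:E ->
  lebesgue (@origin_ball R n r) = t%:E -> s <= r ->
  Psi u * (t - s') <= t `^ mu ->
  (morrey_orlicz_norm Psi mu
    (fun x => u * \1_(@origin_ball R n r `\` origin_ball s) x)%R <= 1)%E.
Proof.
move=> oPsi mu01 u0 /andP[s'0 s't] sE rE sr le_t.
have t0 : 0 < t by exact: le_lt_trans s't.
have Psi0 : 0 <= Psi u by rewrite orlicz_ge0// ltW.
apply: ge_ereal_sup => _ [q /= q0 <-].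
have [v v0 qE] := lebesgue_origin_ball n q q0.
apply: (ball_luxemburg_le _ _ _ _ _ _ v0 ltr01 qE).
rewrite integral_orlicz_indic//; last 2 first.
- exact: measurable_origin_ball.
- exact: measurable_annulus.
rewrite divr1; set E := _ `&` _.
have mE : measurable E.
  by apply: measurableI; [exact: measurable_annulus|exact: measurable_origin_ball].
suff [w le_w Ew] : exists2 w, Psi u * w <= v `^ mu & (lebesgue E <= w%:E)%E.
  apply: (@le_trans _ _ ((Psi u)%:E * w%:E)%E); last by rewrite -EFinM lee_fin.
  by apply: lee_wpmul2l => //; rewrite lee_fin.
have [rq|qr] := leP r q.
  exists (t - s'); first apply: le_trans le_t _.
    case/andP: mu01 => mu0 _.
    apply: ge0_ler_powR; rewrite ?nnegrE ?(ltW t0) ?(ltW v0)//.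
    exact: le_lebesgue_origin_ball rE qE rq.
  rewrite -(lebesgue_annulus _ _ _ _ sE rE sr).
  apply: le_measure; rewrite ?inE//; first exact: measurable_annulus.
  exact: subIsetl.
have [qs|sq] := leP q s.
  exists 0; first by rewrite mulr0 powR_ge0.
  rewrite (_ : E = set0) ?measure0//; apply/seteqP; split=> // x [[_ +] xq].
  by apply; exact: subset_origin_ball xq.
exists (v - s'); last first.
  rewrite -(lebesgue_annulus _ _ _ _ sE qE (ltW sq)).
  apply: le_measure; rewrite ?inE//; first exact: measurable_annulus.
  by move=> x [[_ ?] ?]; split.
have vt : v <= t by exact: le_lebesgue_origin_ball qE rE (ltW qr).
apply: le_trans (ler_powR_scale _ _ _ mu01 _); last by rewrite v0; exact: vt.
apply: (@le_trans _ _ (v / t * (Psi u * (t - s')))); last first.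
  by rewrite ler_wpM2l// divr_ge0// ltW.
rewrite mulrCA ler_wpM2l// mulrBr divfK ?gt_eqF// lerB//.
by rewrite ler_piMl// ler_pdivrMr// mul1r.
Qed.

(** The test function has [Psi]-norm at most 1, hence [Phi]-norm at most [C]. Doubling [C] makes
    this strict, so that the modular over the outer ball, which contains the annulus, can be
    bounded. *)
Lemma embedding_annulus (Phi Psi : R -> R) (lambda mu C u s' t : R) :
  (1 <= n)%N -> orlicz Phi -> orlicz Psi -> 0 <= mu < 1 -> 0 < C ->
  (forall f : Rn R n -> R, morrey_orlicz Psi mu f ->
    (morrey_orlicz_norm Phi lambda f <= C%:E * morrey_orlicz_norm Psi mu f)%E) ->
  0 < u -> 0 <= s' < t -> Psi u * (t - s') <= t `^ mu ->
  Phi (u / (2 * C)) * (t - s') <= t `^ lambda.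
Proof.
move=> n1 oPhi oPsi mu01 C0 emb u0 s't le_t.
have /andP[s'0 s'_lt_t] := s't; have t0 : 0 < t by exact: le_lt_trans s'_lt_t.
have C20 : 0 < 2 * C by rewrite mulr_gt0.
have [s _ sE] := exists_origin_ball_volume n s' n1 s'0.
have [r r_ge0 rE] := exists_origin_ball_volume n t n1 (ltW t0).
have sr : s <= r.
  rewrite leNgt; apply: contraTN s'_lt_t => /ltW rs; rewrite -leNgt.
  exact: le_lebesgue_origin_ball rE sE rs.
have r0 : 0 < r.
  rewrite lt_neqAle r_ge0 andbT; apply/eqP => r0.
  by move: rE; rewrite -r0 origin_ball0 measure0 => -[t_eq0];
    rewrite -t_eq0 ltxx in t0.
pose E := @origin_ball R n r `\` origin_ball s.
have mE : measurable E by exact: measurable_annulus.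
have EE : lebesgue E = (t - s')%:E by exact: lebesgue_annulus.
pose f (x : Rn R n) : R := u * \1_E x.
have f1 : (morrey_orlicz_norm Psi mu f <= 1)%E by exact: annulus_norm_le1 sE rE sr le_t.
have fM : morrey_orlicz Psi mu f.
  split; last by rewrite (le_lt_trans f1)// ltry.
  by apply: loc_integrable_indic => //; rewrite EE ltry.
have : (ball_luxemburg Phi lambda r f < (2 * C)%:E)%E.
  apply: (le_lt_trans (ball_luxemburg_le_norm _ _ _ _ r0)).
  apply: (le_lt_trans (emb _ fM)).
  apply: (@le_lt_trans _ _ (C%:E * 1)%E).
    by apply: lee_wpmul2l => //; rewrite lee_fin ltW.
  by rewrite mule1 lte_fin mulr_natl mulr2n ltrDl.
move=> /(ball_luxemburg_lt _ _ oPhi _ _ _ _ t0 rE).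
rewrite integral_orlicz_indic//; last exact: measurable_origin_ball.
by rewrite setIidl ?EE -?EFinM ?lee_fin// => x [].
Qed.

End necessity.

(** * Equivalence of the embedding with conditions (i) and (ii) *)

Theorem proposition2 (R : realType) (n : nat) (Phi Psi : R -> R)
    (lambda mu : R) :
  (1 <= n)%N -> orlicz Phi -> orlicz Psi ->
  0 <= lambda < 1 -> 0 <= mu < 1 ->
  morrey_orlicz_embedding n Psi mu Phi lambda <->
  exists A1 A2 : R, [/\ 0 < A1, 0 < A2,
    forall u : R, 0 < u ->
      Phi (u / A1) <= Psi u `^ ((lambda - 1) / (mu - 1)) &
    forall u r : R, 0 < u -> 0 < r -> orlicz_inv Psi (r `^ (mu - 1)) < u ->
      Phi (u / A2) <= Psi u * r `^ (lambda - mu)].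
Proof.
move=> n1 oPhi oPsi /andP[_ lambda1] mu01; have /andP[mu0 mu1] := mu01.
have mu1_neq0 : mu - 1 != 0 by rewrite subr_eq0 lt_eqF.
split=> [[_ [C C0 emb]]|[A1 [A2 [A10 A20 H1 H2]]]]; last first.
  pose A := Num.max A1 A2.
  have A0 : 0 < A by rewrite lt_max A10.
  have norm_le (f : Rn R n -> R) : morrey_orlicz Psi mu f ->
      (morrey_orlicz_norm Phi lambda f <=
        (2 * A)%:E * morrey_orlicz_norm Psi mu f)%E.
    by apply: morrey_orlicz_norm_le => // v g v0 g0; exact: le_powR_add.
  split; last by exists (2 * A); [rewrite mulr_gt0|].
  move=> f fM; split; first exact: fM.1.
  apply: le_lt_trans (norm_le _ fM) _; apply: lte_mul_pinfty => //.
  - by rewrite lee_fin ltW// mulr_gt0.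
  - exact: fM.2.
have C20 : 0 < 2 * C by rewrite mulr_gt0.
have key u s' t : 0 < u -> 0 <= s' < t -> Psi u * (t - s') <= t `^ mu ->
    Phi (u / (2 * C)) * (t - s') <= t `^ lambda.
  exact: embedding_annulus emb.
exists (2 * C), (2 * C); split => // [u u0|u r u0 r0].
  have Pu0 : 0 < Psi u by exact: orlicz_gt0.
  (* This is the volume with [Psi u * t = t ^ mu], so [key] applies with [s' = 0]; its conclusion
     divided by [t] is (i). *)
  have [t t0 tE] : exists2 t : R, 0 < t & Psi u = t `^ (mu - 1).
    exists (Psi u `^ (mu - 1)^-1); first exact: powR_gt0.
    by rewrite -powRrM mulVf// powRr1// ltW.
  have tD a : t `^ a = t `^ (a - 1) * t.
    by rewrite -[X in _ * X]powRr1 ?(ltW t0)// -powRD ?subrK//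
      (gt_eqF t0) implybT.
  have -> : Psi u `^ ((lambda - 1) / (mu - 1)) = t `^ (lambda - 1).
    by rewrite tE -powRrM mulrC divfK.
  rewrite -(ler_pM2r t0) -tD -[in leLHS](subr0 t); apply: key => //.
    by rewrite lexx t0.
  by rewrite subr0 tE -tD.
rewrite orlicz_inv_lt ?powR_ge0 ?(ltW u0)// => r_lt.
have Pu0 : 0 < Psi u by exact: orlicz_gt0.
have rmu0 : 0 < r `^ mu by exact: powR_gt0.
(* Here [r] is the volume of the outer ball, not a radius. The side condition of (ii) says exactly
   that an annulus of volume [r ^ mu / Psi u] fits inside. *)
have r_lt' : r `^ mu / Psi u < r.
  rewrite ltr_pdivrMr// mulrC -ltr_pdivrMr//; apply: le_lt_trans r_lt.
  by rewrite powRB ?(gt_eqF r0) ?implybT// powRr1// ltW.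
have := key u (r - r `^ mu / Psi u) r u0.
rewrite subr_ge0 (ltW r_lt') ltrBlDr ltrDl divr_gt0// => /(_ erefl).
rewrite opprB addrC subrK mulrCA divff ?gt_eqF// mulr1 lexx => /(_ erefl).
rewrite mulrA ler_pdivrMr// -ler_pdivlMr// => /le_trans; apply.
by rewrite powRB ?(gt_eqF r0) ?implybT// mulrAC mulrA mulrC mulrA.
Qed.
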